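(* Let $f:[a,b]\times\mathbb{R}\to\mathbb{R}$ be of class $C^\infty$, let $u\in C^\infty[a,b]$ be a solution of $u'(t)=f(t,u(t))$, fix $t_i\in[a,b)$, write $u_i=u(t_i)$, and assume $u_i\neq 0$. Consider the two-stage MQ-RBF-based RK2 method with parameters $$c_2=a_{21}=\tfrac23,\qquad w_1=\tfrac14,\qquad w_2=\tfrac34,$$ and squared shape parameter $$\varepsilon_{2i}^2=\frac{f_t+f f_u}{u_i}=\frac{u''(t_i)}{u_i},$$ where $f,f_t,f_u$ are evaluated at $(t_i,u_i)$. Then the method is third-order accurate, i.e. its local truncation error at $t_i$ satisfies $\tau_i=\mathcal{O}(h^3)$ as $h\to0^+$.
   Context: The MQ-RBF-based RK2 method with step size $h>0$ for $u'=f(t,u)$ takes $\mathbf{u}_i$ to $\mathbf{u}_{i+1}=\mathbf{u}_i+h[w_1K_1+w_2K_2]$, where $$K_1=f(t_i,\mathbf{u}_i),\qquad K_2=f\Big(t_i+c_2h,\ \Big(1+\tfrac{\varepsilon_{2i}^2(c_2h)^2}{2}\Big)\big(\mathbf{u}_i+h a_{21}K_1\big)\Big).$$ The quantity $\varepsilon_{2i}^2$ is treated as a real parameter, which may be negative. The local truncation error at $t_i$ is $$\tau_i=\frac{u(t_i+h)-u(t_i)}{h}-(w_1K_1+w_2K_2),$$ with $K_1,K_2$ computed by the formulas above starting from the exact value $\mathbf{u}_i=u(t_i)$. Order $p$ means $\tau_i=\mathcal{O}(h^p)$ as $h\to0^+$, where $t_i$ and the value of $\varepsilon_{2i}^2$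 are held fixed. *)

(* Defs.v *)
From Stdlib Require Import Reals.
From Coquelicot Require Import Coquelicot.

Open Scope R_scope.

Definition segment (a b : R) : R -> Prop := fun t => a <= t <= b.

Definition strip (a b : R) : R * R -> Prop := fun p => segment a b (fst p).

(* Coquelicot's [is_derive g x l] is [filterdiff g (locally x) (fun y => scal y l)];
   here the increments are restricted to [D], so that on a segment one gets the
   usual derivative, one-sided at the endpoints. *)
Definition is_derive_in (D : R -> Prop) (g : R -> R) (x l : R) : Prop :=
  filterdiff g (within D (locally x)) (fun y => scal y l).

Fixpoint Ck_segment (a b : R) (k : nat) (g : R -> R) : Prop :=
  match k with
  | O => continuous_on (segment a b) g
  | S k' => exists dg : R -> R,
      (forall t, segment a b t -> is_derive_in (segment a b) g t (dg t)) /\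
      Ck_segment a b k' dg
  end.

Definition smooth_segment (a b : R) (g : R -> R) : Prop :=
  forall k : nat, Ck_segment a b k g.

(* [f] stands for a function on [a,b] x R: its values at times outside the
   segment are never constrained. *)
Fixpoint Ck_strip (a b : R) (k : nat) (f : R -> R -> R) : Prop :=
  match k with
  | O => continuous_on (strip a b) (fun p => f (fst p) (snd p))
  | S k' => exists ft fu : R -> R -> R,
      (forall t x, segment a b t ->
         is_derive_in (segment a b) (fun s => f s x) t (ft t x) /\
         is_derive (fun y => f t y) x (fu t x)) /\
      Ck_strip a b k' ft /\ Ck_strip a b k' fu
  end.

Definition smooth_strip (a b : R) (f : R -> R -> R) : Prop :=
  forall k : nat, Ck_strip a b k f.

Definition K1 (f : R -> R -> R) (t x : R) : R := f t x.

(* [eps2] is the squared shape parameter; it may be negative. *)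
Definition K2 (f : R -> R -> R) (c2 a21 eps2 t x h : R) : R :=
  f (t + c2 * h)
    ((1 + eps2 * (c2 * h) ^ 2 / 2) * (x + h * a21 * K1 f t x)).

Definition mq_rbf_rk2_step (f : R -> R -> R) (c2 a21 w1 w2 eps2 t x h : R) : R :=
  x + h * (w1 * K1 f t x + w2 * K2 f c2 a21 eps2 t x h).

Definition truncation_error (f : R -> R -> R) (u : R -> R)
    (c2 a21 w1 w2 eps2 t h : R) : R :=
  (u (t + h) - u t) / h
  - (w1 * K1 f t (u t) + w2 * K2 f c2 a21 eps2 t (u t) h).

Definition is_bigO (F : (R -> Prop) -> Prop) (f g : R -> R) : Prop :=
  exists C : R, F (fun h => Rabs (f h) <= C * Rabs (g h)).

(* Everything but the step size, including [eps2], is fixed as h -> 0+. *)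
Definition accurate_of_order (p : nat) (f : R -> R -> R) (u : R -> R)
    (c2 a21 w1 w2 eps2 t : R) : Prop :=
  is_bigO (at_right 0) (truncation_error f u c2 a21 w1 w2 eps2 t)
          (fun h => h ^ p).

(* Main.v *)
(* With [s = 2h/3] and [eps2 * u ti = u''(ti)], the argument of [f] in the second
   stage is [u + s f + s^2 u'' / 2 + O(s^3) = u (ti + s) + O(h^3)]. As [f] is
   locally Lipschitz in its second variable, [K2 = u'(ti + s) + O(h^3)], so that
   up to [O(h^3)] the truncation error is the error of the two-point Radau
   quadrature [u'(ti) / 4 + 3 u'(ti + s) / 4] for the mean of [u'] over a step,
   which is exact for quadratic [u']. All derivatives in time are one-sided at
   the ends of the segment. *)
Require Import Defs.
From Stdlib Require Import Reals Lra.
From Coquelicot Require Import Coquelicot.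

Open Scope R_scope.

(** * One-sided derivatives on a segment and mean value estimates for them *)

Lemma within_locally_R (D P : R -> Prop) (x : R) :
  within D (locally x) P <->
  exists d, 0 < d /\ forall y, D y -> Rabs (y - x) < d -> P y.
Proof.
  split.
  - intros [d Hd]. exists d. split; [apply cond_pos|].
    intros y Dy Hy. exact (Hd y Hy Dy).
  - intros [d [Hd0 Hd]]. exists (mkposreal d Hd0).
    intros y Hy Dy. exact (Hd y Dy Hy).
Qed.

Lemma at_right_0 (P : R -> Prop) :
  at_right 0 P <-> exists d, 0 < d /\ forall h, 0 < h < d -> P h.
Proof.
  unfold at_right. rewrite within_locally_R.
  split; intros [d [Hd0 Hd]]; exists d; (split; [exact Hd0|]).
  - intros h Hh. apply Hd; [lra|]. rewrite Rabs_pos_eq; lra.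
  - intros h Hh Hhd. apply Hd. rewrite Rabs_pos_eq in Hhd; lra.
Qed.

Lemma is_derive_in_eps (D : R -> Prop) (g : R -> R) (x l : R) :
  is_derive_in D g x l ->
  forall eps, 0 < eps ->
  within D (locally x)
    (fun y => Rabs (g y - g x - (y - x) * l) <= eps * Rabs (y - x)).
Proof.
  intros [_ H] eps Heps.
  apply (H x) with (eps := mkposreal eps Heps).
  intros P HP. now apply filter_le_within.
Qed.

Lemma is_derive_in_continuous (D : R -> Prop) (g : R -> R) (x l : R) :
  is_derive_in D g x l -> filterlim g (within D (locally x)) (locally (g x)).
Proof.
  intros H.
  apply (filterdiff_continuous_aux (U := R_NormedModule) (V := R_NormedModule) g).
  - now exists (fun y => scal y l).
  - intros P HP. now apply filter_le_within.
Qed.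

Lemma is_derive_in_interior (D : R -> Prop) (g : R -> R) (x l : R) :
  locally x D -> is_derive_in D g x l -> is_derive g x l.
Proof.
  intros HD [Hl H]. split; [exact Hl|].
  intros y Hy eps.
  generalize (filter_and _ _ HD
    (H y (fun P HP => filter_le_within _ _ (Hy P HP)) eps)).
  apply filter_imp. now intros z [Dz Hz]; apply Hz.
Qed.

Lemma segment_locally (a b t : R) : a < t < b -> locally t (segment a b).
Proof.
  intros Ht. apply (filter_and (fun y => a <= y) (fun y => y <= b)).
  - apply (filter_imp (fun y => a < y)); [intros; lra|]. now apply open_gt.
  - apply (filter_imp (fun y => y < b)); [intros; lra|]. now apply open_lt.
Qed.

Lemma at_right_segment (a b t : R) (P : R -> Prop) :
  a <= t < b -> within (segment a b) (locally t) P ->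
  at_right 0 (fun h => P (t + h)).
Proof.
  intros Ht [d [Hd0 Hd]]%within_locally_R. apply at_right_0.
  exists (Rmin d (b - t)). split; [apply Rmin_glb_lt; lra|].
  intros h [Hh Hhd].
  assert (h < d) by (eapply Rlt_le_trans; [exact Hhd | apply Rmin_l]).
  assert (h < b - t) by (eapply Rlt_le_trans; [exact Hhd | apply Rmin_r]).
  apply Hd; [unfold segment; lra|].
  replace (t + h - t) with h by ring. rewrite Rabs_pos_eq; lra.
Qed.

(** Limits along [at_right 0] are unique, so any two derivatives of [g] at a point left of [b] can
    be identified through their right quotients. The same device later compares functions known to
    agree only to the right of a point. *)
Lemma is_derive_in_right_quotient (a b : R) (g : R -> R) (t l : R) :
  a <= t < b -> is_derive_in (segment a b) g t l ->
  filterlim (fun h => (g (t + h) - g t) / h) (at_right 0) (locally l).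
Proof.
  intros Ht Hg. apply filterlim_locally. intros eps.
  assert (He : 0 < eps / 2) by (generalize (cond_pos eps); lra).
  generalize (at_right_segment _ _ _ _ Ht (is_derive_in_eps _ _ _ _ Hg _ He)).
  intros [d [Hd0 Hd]]%at_right_0. apply at_right_0. exists d. split; [exact Hd0|].
  intros h Hh. specialize (Hd h Hh).
  change (Rabs ((g (t + h) - g t) / h - l) < eps).
  replace (t + h - t) with h in Hd by ring.
  rewrite (Rabs_pos_eq h) in Hd by lra.
  replace ((g (t + h) - g t) / h - l) with ((g (t + h) - g t - h * l) / h)
    by (field; lra).
  unfold Rdiv. rewrite Rabs_mult, Rabs_inv, (Rabs_pos_eq h) by lra.
  apply Rle_lt_trans with (eps / 2); [|generalize (cond_pos eps); lra].
  apply Rmult_le_reg_r with h; [lra|]. rewrite Rmult_assoc, Rinv_l; lra.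
Qed.

Lemma is_derive_in_unique (a b : R) (g : R -> R) (t l m : R) :
  a <= t < b -> is_derive_in (segment a b) g t l ->
  is_derive_in (segment a b) g t m -> l = m.
Proof.
  intros Ht Hl Hm.
  eapply (filterlim_locally_unique (F := at_right 0));
    eapply is_derive_in_right_quotient; eassumption.
Qed.

(* Freezing [g] outside [x, y] makes its one-sided continuity at the endpoints
   two-sided, as the mean value theorem of the library requires. *)
Lemma MVT_segment (a b x y : R) (g dg P dP : R -> R) :
  a <= x -> x < y -> y <= b ->
  (forall t, x <= t <= y -> is_derive_in (segment a b) g t (dg t)) ->
  (forall t, is_derive P t (dP t)) ->
  exists c, x <= c <= y /\
    (g y - P y) - (g x - P x) = (dg c - dP c) * (y - x).
Proof.
  intros Hax Hxy Hyb Hg HP.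
  set (clamp := fun t => Rmax x (Rmin t y)).
  assert (Hclamp : forall t, x <= t <= y -> clamp t = t).
  { intros t Ht. unfold clamp. rewrite Rmin_left, Rmax_right; lra. }
  assert (Hrange : forall t, x <= clamp t <= y).
  { intros t. unfold clamp. split; [apply Rmax_l|].
    apply Rmax_lub; [lra | apply Rmin_r]. }
  assert (Hlip : forall s t, Rabs (clamp s - clamp t) <= Rabs (s - t)).
  { intros s t. unfold clamp, Rmax, Rmin, Rabs.
    repeat destruct Rle_dec; repeat destruct Rcase_abs; lra. }
  destruct (MVT_gen (fun t => g (clamp t) - P t) x y (fun t => dg t - dP t))
    as [c [Hc Ec]].
  - rewrite Rmin_left, Rmax_right by lra. intros t Ht.
    apply (is_derive_minus (fun t => g (clamp t)) P); [|apply HP].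
    apply is_derive_ext_loc with g.
    + apply (filter_imp (segment x y)); [|now apply segment_locally].
      intros s Hs. now rewrite Hclamp.
    + apply is_derive_in_interior with (segment a b).
      * apply segment_locally; lra.
      * apply Hg; lra.
  - rewrite Rmin_left, Rmax_right by lra. intros t Ht.
    apply continuity_pt_minus.
    + apply continuity_pt_filterlim, filterlim_locally. intros eps.
      generalize (is_derive_in_continuous _ _ _ _ (Hg t Ht)).
      rewrite filterlim_locally. intros H.
      destruct (proj1 (within_locally_R _ _ _) (H eps)) as [d [Hd0 Hd]].
      exists (mkposreal d Hd0). intros s Hs. rewrite (Hclamp t Ht).
      apply Hd; [split; generalize (Hrange s); lra|].
      rewrite <- (Hclamp t Ht).
      eapply Rle_lt_trans; [apply Hlip | exact Hs].
    + apply continuity_pt_filterlim.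
      apply (ex_derive_continuous P). exists (dP t). apply HP.
  - rewrite Rmin_left, Rmax_right in Hc by lra. exists c. split; [exact Hc|].
    rewrite <- Ec. rewrite !Hclamp by lra. ring.
Qed.

(** The mean value theorem replaces integration: the increment of [g - P] from [x] to [t] is at most
    [t - x] times a bound on its derivative. The factor [1 / (n + 1)] of a true integral is given
    up, so the same [M] survives iteration. *)
Lemma remainder_integrate (a b x r M : R) (n : nat) (g dg P dP : R -> R) :
  a <= x -> r <= b ->
  (forall t, x <= t <= r -> is_derive_in (segment a b) g t (dg t)) ->
  (forall t, is_derive P t (dP t)) -> g x = P x ->
  (forall t, x <= t <= r -> Rabs (dg t - dP t) <= M * (t - x) ^ n) ->
  forall t, x <= t <= r -> Rabs (g t - P t) <= M * (t - x) ^ S n.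
Proof.
  intros Hax Hrb Hg HP Hx HM t Ht.
  destruct (Req_dec x t) as [<-|Hne].
  { rewrite Hx. unfold Rminus. rewrite !Rplus_opp_r, Rabs_R0. simpl. lra. }
  destruct (MVT_segment a b x t g dg P dP) as [c [Hc Ec]]; try lra.
  { intros s Hs. apply Hg. lra. }
  { exact HP. }
  replace (g t - P t) with ((dg c - dP c) * (t - x)) by (rewrite <- Ec, Hx; ring).
  rewrite Rabs_mult, (Rabs_pos_eq (t - x)) by lra.
  replace (M * (t - x) ^ S n) with (M * (t - x) ^ n * (t - x)) by (simpl; ring).
  apply Rmult_le_compat_r; [lra|].
  eapply Rle_trans; [apply HM; lra|].
  apply Rmult_le_compat_l; [|apply pow_incr; lra].
  (* The sign of [M] is read off the bound at [t]: an absolute value lies below [M] times a positive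
     power. *)
  assert (H := HM t Ht). assert (0 < (t - x) ^ n) by (apply pow_lt; lra).
  assert (0 <= M * (t - x) ^ n) by (eapply Rle_trans; [apply Rabs_pos | exact H]).
  apply Rmult_le_reg_r with ((t - x) ^ n); lra.
Qed.


(** * Continuity on the strip and the chain rule along a curve *)

Lemma MVT_ball (g dg : R -> R) (p d x y : R) :
  (forall z, is_derive g z (dg z)) -> Rabs (x - p) < d -> Rabs (y - p) < d ->
  exists c, Rabs (c - p) < d /\ g y - g x = dg c * (y - x).
Proof.
  intros Hg Hx Hy.
  destruct (MVT_gen g x y dg) as [c [Hc Ec]].
  - intros z _. apply Hg.
  - intros z _. apply continuity_pt_filterlim.
    apply (ex_derive_continuous g). exists (dg z). apply Hg.
  - exists c. split; [|exact Ec].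
    apply Rabs_def2 in Hx. apply Rabs_def2 in Hy. apply Rabs_def1;
      revert Hc; unfold Rmin, Rmax; destruct Rle_dec; lra.
Qed.

Lemma continuous_on_strip_eps (a b t x : R) (g : R -> R -> R) :
  continuous_on (strip a b) (fun p => g (fst p) (snd p)) -> segment a b t ->
  forall eps, 0 < eps -> exists d, 0 < d /\
    forall s y, segment a b s -> Rabs (s - t) < d -> Rabs (y - x) < d ->
      Rabs (g s y - g t x) < eps.
Proof.
  intros Hg Ht eps Heps.
  assert (H := Hg (t, x) Ht). rewrite filterlim_locally in H.
  destruct (H (mkposreal eps Heps)) as [d Hd].
  exists d. split; [apply cond_pos|].
  intros s y Ss Hs Hy. exact (Hd (s, y) (conj Hs Hy) Ss).
Qed.

Lemma is_derive_in_right_continuous (a b : R) (v : R -> R) (t l : R) :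
  a <= t < b -> is_derive_in (segment a b) v t l ->
  forall eps, 0 < eps -> at_right 0 (fun h => Rabs (v (t + h) - v t) < eps).
Proof.
  intros Ht Hv eps Heps.
  apply (at_right_segment a b t (fun s => Rabs (v s - v t) < eps) Ht).
  assert (H := is_derive_in_continuous _ _ _ _ Hv).
  rewrite filterlim_locally in H. exact (H (mkposreal eps Heps)).
Qed.

(** The increment of [f] along [v] is split at the point [(t + h, v t)]. The time part is a
    difference quotient at frozen state; the state part is a slope times the quotient of [v], and
    the slope tends to [fu t (v t)] by the mean value theorem and the joint continuity of [fu]. *)
Lemma chain_rule_right (a b : R) (f fu : R -> R -> R) (v : R -> R) (t ft dv : R) :
  a <= t < b ->
  (forall s x, segment a b s -> is_derive (fun y => f s y) x (fu s x)) ->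
  continuous_on (strip a b) (fun p => fu (fst p) (snd p)) ->
  is_derive_in (segment a b) (fun s => f s (v t)) t ft ->
  is_derive_in (segment a b) v t dv ->
  filterlim (fun h => (f (t + h) (v (t + h)) - f t (v t)) / h) (at_right 0)
    (locally (fu t (v t) * dv + ft)).
Proof.
  intros Ht Hfu Cfu Hft Hv.
  assert (St : segment a b t) by (unfold segment; lra).
  (* Where [v (t + h) = v t] the slope is 0/0. Giving it its expected limit keeps both the
     convergence and the factorisation of the increment valid there. *)
  set (slope := fun h => if Req_EM_T (v (t + h)) (v t) then fu t (v t)
    else (f (t + h) (v (t + h)) - f (t + h) (v t)) / (v (t + h) - v t)).
  assert (Hslope : filterlim slope (at_right 0) (locally (fu t (v t)))).
  { apply filterlim_locally. intros eps.
    destruct (continuous_on_strip_eps a b t (v t) fu Cfu St eps (cond_pos eps))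
      as [d [Hd0 Hd]].
    generalize (filter_and _ _
      (is_derive_in_right_continuous _ _ _ _ _ Ht Hv d Hd0)
      (at_right_segment a b t (fun s => segment a b s /\ Rabs (s - t) < d) Ht
        (proj2 (within_locally_R _ _ _)
          (ex_intro _ d (conj Hd0 (fun y Dy Hy => conj Dy Hy)))))).
    apply filter_imp. intros h [Hvh [Sh Hh]].
    change (Rabs (slope h - fu t (v t)) < eps). unfold slope.
    destruct Req_EM_T as [E|E].
    - unfold Rminus. rewrite Rplus_opp_r, Rabs_R0. apply cond_pos.
    - destruct (MVT_ball (fun y => f (t + h) y) (fu (t + h)) (v t) d (v t) (v (t + h)))
        as [c [Hc Ec]].
      + intros z. now apply Hfu.
      + unfold Rminus. now rewrite Rplus_opp_r, Rabs_R0.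
      + exact Hvh.
      + rewrite Ec.
        replace (_ / _) with (fu (t + h) c) by (field; lra).
        now apply Hd. }
  apply filterlim_ext_loc with
    (fun h => slope h * ((v (t + h) - v t) / h) + (f (t + h) (v t) - f t (v t)) / h).
  - apply at_right_0. exists 1. split; [lra|]. intros h Hh. unfold slope.
    destruct Req_EM_T as [E|E].
    + rewrite E. field. lra.
    + field. lra.
  - apply (filterlim_comp_2 (G := locally (fu t (v t) * dv)) (H := locally ft)
      (fun h => slope h * ((v (t + h) - v t) / h)) _ Rplus).
    + apply (filterlim_comp_2 (G := locally (fu t (v t))) (H := locally dv)
        slope _ Rmult).
      * exact Hslope.
      * now apply (is_derive_in_right_quotient a b).
      * exact (filterlim_mult (K := R_AbsRing) (fu t (v t)) dv).
    + now apply (is_derive_in_right_quotient a b (fun s => f s (v t))).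
    + exact (filterlim_plus (V := R_NormedModule) (fu t (v t) * dv) ft).
Qed.

(** * Taylor expansion of the solution to the right of a point *)

Lemma Ck_segment_4_taylor (a b x : R) (u : R -> R) :
  a <= x < b -> Ck_segment a b 4 u ->
  exists (u1 u2 : R -> R) (v3 M d : R), 0 < d /\ 0 <= M /\
    (forall t, segment a b t -> is_derive_in (segment a b) u t (u1 t)) /\
    (forall t, segment a b t -> is_derive_in (segment a b) u1 t (u2 t)) /\
    forall h, 0 <= h < d ->
      Rabs (u1 (x + h) - (u1 x + u2 x * h + v3 / 2 * h ^ 2)) <= M * h ^ 3 /\
      Rabs (u (x + h) - (u x + u1 x * h + u2 x / 2 * h ^ 2 + v3 / 6 * h ^ 3))
        <= M * h ^ 4.
Proof.
  intros Hx [u1 [D1 [u2 [D2 [u3 [D3 [u4 [D4 C4]]]]]]]].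
  assert (Sx : segment a b x) by (unfold segment; lra).
  assert (H := C4 x Sx). rewrite filterlim_locally in H.
  destruct (proj1 (within_locally_R _ _ _) (H (mkposreal 1 Rlt_0_1)))
    as [d [Hd0 Hd]].
  (* By continuity [u4] stays within 1 of [u4 x] at distance less than [d]; halving [d] keeps the
     closed interval from [x] to [r] inside that neighbourhood. *)
  set (M := Rabs (u4 x) + 1).
  set (r := x + Rmin (d / 2) (b - x)).
  assert (Hm : 0 < Rmin (d / 2) (b - x)) by (apply Rmin_glb_lt; lra).
  assert (Hrd : r <= x + d / 2)
    by (unfold r; apply Rplus_le_compat_l, Rmin_l).
  assert (Hrb : r <= b)
    by (generalize (Rmin_r (d / 2) (b - x)); unfold r; lra).
  assert (Sr : forall t, x <= t <= r -> segment a b t)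
    by (intros; unfold segment; lra).
  (* The bound on the fourth derivative is a remainder estimate of exponent 0 against the zero
     polynomial; each integration below raises the exponent by one and lowers the order of the
     derivative by one. *)
  assert (B4 : forall t, x <= t <= r -> Rabs (u4 t - 0) <= M * (t - x) ^ 0).
  { intros t Ht. replace (u4 t - 0) with (u4 x + (u4 t - u4 x)) by ring.
    simpl. rewrite Rmult_1_r. unfold M.
    eapply Rle_trans; [apply Rabs_triang|]. apply Rplus_le_compat_l, Rlt_le.
    apply (Hd t); [now apply Sr | rewrite Rabs_pos_eq; lra]. }
  assert (B3 := remainder_integrate a b x r M 0 u3 u4
    (fun _ => u3 x) (fun _ => 0)
    ltac:(lra) Hrb (fun t Ht => D4 t (Sr t Ht))
    ltac:(intros; auto_derive; [easy | ring]) ltac:(cbv beta; ring) B4).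
  assert (B2 := remainder_integrate a b x r M 1 u2 u3
    (fun t => u2 x + u3 x * (t - x)) (fun _ => u3 x)
    ltac:(lra) Hrb (fun t Ht => D3 t (Sr t Ht))
    ltac:(intros; auto_derive; [easy | ring]) ltac:(cbv beta; ring) B3).
  assert (B1 := remainder_integrate a b x r M 2 u1 u2
    (fun t => u1 x + u2 x * (t - x) + u3 x / 2 * (t - x) ^ 2)
    (fun t => u2 x + u3 x * (t - x))
    ltac:(lra) Hrb (fun t Ht => D2 t (Sr t Ht))
    ltac:(intros; auto_derive; [easy | field]) ltac:(cbv beta; ring) B2).
  assert (B0 := remainder_integrate a b x r M 3 u u1
    (fun t => u x + u1 x * (t - x) + u2 x / 2 * (t - x) ^ 2 + u3 x / 6 * (t - x) ^ 3)
    (fun t => u1 x + u2 x * (t - x) + u3 x / 2 * (t - x) ^ 2)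
    ltac:(lra) Hrb (fun t Ht => D1 t (Sr t Ht))
    ltac:(intros; auto_derive; [easy | field]) ltac:(cbv beta; ring) B1).
  exists u1, u2, (u3 x), M, (r - x).
  split; [unfold r; lra|].
  split; [unfold M; generalize (Rabs_pos (u4 x)); lra|]. split; [exact D1|]. split; [exact D2|].
  intros h Hh. assert (Ht : x <= x + h <= r) by lra.
  specialize (B1 _ Ht). specialize (B0 _ Ht). cbv beta in B0, B1.
  replace (x + h - x) with h in B0, B1 by ring. now split.
Qed.

(** * Lipschitz bound in the state, the differentiated equation, and the quadrature error *)

Lemma strip_locally_Lipschitz (a b t x : R) (f fu : R -> R -> R) :
  segment a b t ->
  (forall s y, segment a b s -> is_derive (fun z => f s z) y (fu s y)) ->
  continuous_on (strip a b) (fun p => fu (fst p) (snd p)) ->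
  exists L d, 0 <= L /\ 0 < d /\ forall s y z, segment a b s ->
    Rabs (s - t) < d -> Rabs (y - x) < d -> Rabs (z - x) < d ->
    Rabs (f s z - f s y) <= L * Rabs (z - y).
Proof.
  intros St Hfu Cfu.
  destruct (continuous_on_strip_eps a b t x fu Cfu St 1 Rlt_0_1) as [d [Hd0 Hd]].
  exists (Rabs (fu t x) + 1), d.
  split; [generalize (Rabs_pos (fu t x)); lra|]. split; [exact Hd0|].
  intros s y z Ss Hs Hy Hz.
  destruct (MVT_ball (fun w => f s w) (fu s) x d y z) as [c [Hc Ec]];
    [intros w; now apply Hfu | exact Hy | exact Hz |].
  rewrite Ec, Rabs_mult. apply Rmult_le_compat_r; [apply Rabs_pos|].
  replace (fu s c) with (fu t x + (fu s c - fu t x)) by ring.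
  eapply Rle_trans; [apply Rabs_triang|].
  apply Rplus_le_compat_l, Rlt_le. now apply Hd.
Qed.

(** By the equation, [du] and [f] along the solution have the same right difference quotients at
    [t]. One limit is [ddu], the other is given by the chain rule. *)
Lemma ode_second_derivative (a b : R) (f fu : R -> R -> R) (u du : R -> R)
    (t ft ddu : R) :
  a <= t < b ->
  (forall s x, segment a b s -> is_derive (fun y => f s y) x (fu s x)) ->
  continuous_on (strip a b) (fun p => fu (fst p) (snd p)) ->
  (forall s, segment a b s -> is_derive_in (segment a b) u s (du s)) ->
  (forall s, segment a b s -> du s = f s (u s)) ->
  is_derive_in (segment a b) (fun s => f s (u t)) t ft ->
  is_derive_in (segment a b) du t ddu ->
  ddu = ft + f t (u t) * fu t (u t).
Proof.
  intros Ht Hfu Cfu Hu Hode Hft Hddu.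
  assert (St : segment a b t) by (unfold segment; lra).
  apply (filterlim_locally_unique (K := R_AbsRing) (V := R_NormedModule)
    (F := at_right 0) (fun h => (du (t + h) - du t) / h)).
  - now apply (is_derive_in_right_quotient a b).
  - replace (ft + f t (u t) * fu t (u t)) with (fu t (u t) * du t + ft)
      by (rewrite (Hode t St); ring).
    eapply filterlim_ext_loc;
      [|now apply (chain_rule_right a b f fu u t ft (du t)); auto].
    apply at_right_0. exists (b - t). split; [lra|]. intros h Hh.
    rewrite (Hode t St), (Hode (t + h)); [reflexivity | unfold segment; lra].
Qed.

(* The weights and nodes are those of the two-point Radau quadrature, exact on
   the quadratic part of the derivative. *)
Lemma radau_remainder (v0 v1 v2 v3 vh ws k M E h : R) :
  0 < h ->
  Rabs (vh - (v0 + v1 * h + v2 / 2 * h ^ 2 + v3 / 6 * h ^ 3)) <= M * h ^ 4 ->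
  Rabs (ws - (v1 + v2 * (2 / 3 * h) + v3 / 2 * (2 / 3 * h) ^ 2))
    <= M * (2 / 3 * h) ^ 3 ->
  Rabs (ws - k) <= E * (2 / 3 * h) ^ 3 ->
  0 <= M -> 0 <= E ->
  Rabs ((vh - v0) / h - (1 / 4 * v1 + 3 / 4 * k)) <= (2 * M + E) * h ^ 3.
Proof.
  intros Hh H1 H2 H3 HM HE.
  set (r := vh - _) in H1. set (q := ws - (_ + _)) in H2.
  (* The polynomial parts cancel because 3/4 * 2/3 = 1/2 and 3/4 * 1/2 * (2/3)^2 = 1/6. *)
  replace (_ - _) with (r / h + (3 / 4 * (ws - k) - 3 / 4 * q))
    by (unfold r, q; field; lra).
  assert (H4 : Rabs (r / h) <= M * h ^ 3).
  { unfold Rdiv. rewrite Rabs_mult, Rabs_inv, (Rabs_pos_eq h) by lra.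
    apply Rmult_le_reg_r with h; [exact Hh|].
    rewrite Rmult_assoc, Rinv_l by lra. lra. }
  assert (Hp : 0 < h ^ 3) by now apply pow_lt.
  (* As 3/4 * 8/27 = 2/9, the total is at most [M + 2/9 * (M + E)] times [h ^ 3], within the claimed
     constant. *)
  replace ((2 / 3 * h) ^ 3) with (8 / 27 * h ^ 3) in H2, H3 by field.
  apply Rabs_le_between in H2. apply Rabs_le_between in H3.
  apply Rabs_le_between in H4. apply Rabs_le_between.
  assert (0 <= M * h ^ 3) by (apply Rmult_le_pos; lra).
  assert (0 <= E * h ^ 3) by (apply Rmult_le_pos; lra).
  lra.
Qed.

(** * Third-order accuracy of the method *)

Theorem mainTheorem1
    (a b : R) (f : R -> R -> R) (u du : R -> R)
    (ti ft fu ddu eps2 : R)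
    (hf : smooth_strip a b f)
    (hu : smooth_segment a b u)
    (hdu : forall t, segment a b t -> is_derive_in (segment a b) u t (du t))
    (hode : forall t, segment a b t -> du t = f t (u t))
    (hti : a <= ti < b)
    (hu0 : u ti <> 0)
    (hft : is_derive_in (segment a b) (fun s => f s (u ti)) ti ft)
    (hfu : is_derive (fun y => f ti y) (u ti) fu)
    (hddu : is_derive_in (segment a b) du ti ddu)
    (heps2 : eps2 = (ft + f ti (u ti) * fu) / u ti) :
    eps2 = ddu / u ti /\
    accurate_of_order 3 f u (2 / 3) (2 / 3) (1 / 4) (3 / 4) eps2 ti.
Proof.
  assert (Sti : segment a b ti) by (unfold segment; lra).
  destruct (hf 1%nat) as [gt [gu [Dg [_ Cgu]]]].
  assert (Dgu : forall s x, segment a b s -> is_derive (fun y => f s y) x (gu s x))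
    by (intros s x Ss; apply (Dg s x Ss)).
  assert (Egu : gu ti (u ti) = fu).
  { rewrite <- (is_derive_unique _ _ _ hfu). symmetry.
    now apply is_derive_unique, Dgu. }
  assert (Hddu : ddu = ft + f ti (u ti) * fu).
  { rewrite <- Egu. now apply (ode_second_derivative a b f gu u du). }
  rewrite <- Hddu in heps2. split; [exact heps2|].
  destruct (Ck_segment_4_taylor a b ti u hti (hu 4%nat))
    as [u1 [u2 [v3 [M [d [Hd0 [HM [D1 [D2 HT]]]]]]]]].
  (* The derivative [u1] supplied by smoothness agrees with [du] by uniqueness; [b] is excluded
     since the uniqueness argument uses right quotients. *)
  assert (Edu : forall h, 0 <= h < b - ti -> u1 (ti + h) = f (ti + h) (u (ti + h))).
  { intros h Hh. assert (segment a b (ti + h)) by (unfold segment; lra).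
    rewrite <- hode by assumption.
    apply (is_derive_in_unique a b u (ti + h)); auto; lra. }
  assert (E1 : u1 ti = f ti (u ti)).
  { rewrite <- (Rplus_0_r ti). apply Edu. lra. }
  assert (E2 : u2 ti = ddu).
  { apply (filterlim_locally_unique (K := R_AbsRing) (V := R_NormedModule)
      (F := at_right 0) (fun h => (u1 (ti + h) - u1 ti) / h)).
    - apply (is_derive_in_right_quotient a b); auto.
    - eapply filterlim_ext_loc;
        [|exact (is_derive_in_right_quotient a b du ti ddu hti hddu)].
      apply at_right_0. exists (b - ti). split; [lra|]. intros h Hh.
      rewrite Edu, E1, !hode by (unfold segment; lra). reflexivity. }
  rewrite E1, E2 in HT.
  destruct (strip_locally_Lipschitz a b ti (u ti) f gu Sti Dgu Cgu)
    as [L [r [HL [Hr HLip]]]].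
  set (F := f ti (u ti)) in *.
  (* [y h] is the state argument of the second stage. It tends to [u ti], so it enters the ball
     where [f] is Lipschitz. *)
  set (y := fun h => (1 + eps2 * (2 / 3 * h) ^ 2 / 2) * (u ti + h * (2 / 3) * F)).
  assert (Hy : at_right 0 (fun h => Rabs (y h - u ti) < r)).
  { apply filter_le_within.
    assert (Cy : continuous y 0)
      by (apply (ex_derive_continuous y); unfold y; auto_derive; easy).
    assert (Ey : y 0 = u ti) by (unfold y; field).
    unfold continuous in Cy. rewrite Ey in Cy.
    exact (proj1 (filterlim_locally y (u ti)) Cy (mkposreal r Hr)). }
  apply at_right_0 in Hy. destruct Hy as [d1 [Hd1 Hy]].
  destruct (proj1 (at_right_0 _)
    (is_derive_in_right_continuous a b u ti (du ti) hti (hdu ti Sti) r Hr))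
    as [d2 [Hd2 Hu]].
  (* Expanding [y h] in [s = 2 / 3 * h] leaves the cubic term [eps2 * F / 2], against [v3 / 6] for
     the solution. The extra [M] absorbs the quartic Taylor remainder, and [L] carries the
     discrepancy through [f]. *)
  set (E := L * (Rabs (eps2 * F / 2 - v3 / 6) + M)).
  assert (HE : 0 <= E).
  { apply Rmult_le_pos; [exact HL|].
    generalize (Rabs_pos (eps2 * F / 2 - v3 / 6)); lra. }
  exists (2 * M + E).
  apply at_right_0.
  (* The bound 1 gives [s ^ 4 <= s ^ 3]; [b - ti] keeps times in the segment, [d] validates the
     Taylor bounds, [r] the Lipschitz bound in time, and [d1], [d2] keep the stage value and the
     solution in the Lipschitz ball. *)
  set (m := Rmin (Rmin (Rmin 1 (b - ti)) (Rmin d r)) (Rmin d1 d2)).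
  exists m. split; [unfold m; repeat apply Rmin_glb_lt; lra|].
  intros h Hh.
  assert (Hh' : h < 1 /\ h < b - ti /\ h < d /\ h < r /\ h < d1 /\ h < d2).
  { destruct Hh as [_ Hh]. unfold m in Hh.
    repeat apply Rmin_Rgt_l in Hh as [Hh ?].
    repeat match goal with H : Rmin _ _ > _ |- _ => apply Rmin_Rgt_l in H as [? ?] end.
    lra. }
  rewrite (Rabs_pos_eq (h ^ 3)) by (apply pow_le; lra).
  unfold truncation_error, K2, K1. fold F. fold (y h).
  set (s := 2 / 3 * h).
  destruct (HT h ltac:(lra)) as [_ T0].
  destruct (HT s ltac:(unfold s; lra)) as [T1 T0s].
  apply radau_remainder with ddu v3 (u1 (ti + s)) ; try assumption; try lra.
  fold s. rewrite Edu by (unfold s; lra). unfold E. rewrite Rmult_assoc.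
  eapply Rle_trans.
  - apply HLip.
    + unfold segment, s; lra.
    + replace (ti + s - ti) with s by ring. rewrite Rabs_pos_eq; unfold s; lra.
    + apply Hy; lra.
    + apply Hu; unfold s; lra.
  - apply Rmult_le_compat_l; [exact HL|].
    assert (Hs : 0 < s < 1) by (unfold s; lra).
    assert (Hs3 : 0 < s ^ 3) by (apply pow_lt; lra).
    (* [eps2 * u ti = ddu] makes the stage value match [u] up to second order *)
    set (R0 := u (ti + s) - _) in T0s.
    replace (u (ti + s) - y h) with (R0 - (eps2 * F / 2 - v3 / 6) * s ^ 3)
      by (unfold R0, y; fold s; rewrite heps2; unfold s; field; exact hu0).
    eapply Rle_trans; [apply Rabs_triang|].
    rewrite Rabs_Ropp, Rabs_mult, (Rabs_pos_eq (s ^ 3)) by lra.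
    assert (M * s ^ 4 <= M * s ^ 3).
    { apply Rmult_le_compat_l; [exact HM|]. simpl in *.
      rewrite <- (Rmult_1_l (s * (s * (s * 1)))) at 2.
      apply Rmult_le_compat_r; lra. }
    lra.
Qed.
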